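(* Let $T$ be a set, let $X=\{X_t\}_{t\in T}$ be a simple max-stable process with ECF $\theta$, and let $M$ be a non-empty finite subset of $T$. Then $$\mathbb{P}(X_t\le x_t,\ t\in M)\ \ge\ \exp\Bigl(-\sum_{\varnothing\neq L\subset M}\tau^M_L\bigvee_{t\in L}\frac1{x_t}\Bigr)\qquad\text{for all }x\in[0,\infty)^M,$$ where the coefficients $$\tau^M_L=\sum_{I\subset L}(-1)^{|I|+1}\theta\bigl((M\setminus L)\cup I\bigr)$$ depend only on $\theta$. Equality holds if $X$ is the Tawn–Molchanov (TM) process $X^*$ with ECF $\theta$.
   Context: Conventions: $1/0=\infty$, $0\cdot\infty=0$, $\exp(-\infty)=0$. $\mathcal{F}(T)$ is the set of finite subsets of $T$. Simple max-stable process: a process $X=\{X_t\}_{t\in T}$ with $\mathbb{P}(X_t\le x)=e^{-1/x}$ for all $t\in T$, $x>0$, such that for every $n\in\mathbb{N}$ and independent copies $X^{(1)},\dots,X^{(n)}$ of $X$ the process $\{\bigvee_{i=1}^nX^{(i)}_t\}_{t\in T}$ has the same law (finite-dimensional distributions) as $\{nX_t\}_{t\in T}$. Extremal coefficient function (ECF) of a simple max-stable process $X$: $\theta:\mathcal{F}(T)\to[0,\infty)$ with $\theta(\varnothing)=0$ and $\theta(A)=-x\log\mathbb{P}(\bigvee_{t\in A}X_t\le x)$ for non-empty finite $A\subset T$ (independent of $x>0$). TM process with ECF $\theta$ (where $\theta$ is the ECF of some simple max-stable process on $T$): the simple max-stable process $X^*$ on $T$ (unique in law; its ECF is again $\theta$)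 with $-\log\mathbb{P}(X^*_t\le x_t,\ t\in M)=\sum_{\varnothing\neq L\subset M}\tau^M_L\bigvee_{t\in L}\frac1{x_t}$ for every non-empty finite $M\subset T$ and $x\in(0,\infty)^M$, with $\tau^M_L$ given by the formula in the claim. *)

(* Defs.v *)
From HB Require Import structures.
From mathcomp Require Import all_boot all_order all_algebra finmap.
From mathcomp Require Import all_classical all_reals all_analysis.

Set Implicit Arguments.
Unset Strict Implicit.
Unset Printing Implicit Defensive.

Import Order.TTheory GRing.Theory Num.Theory.
Import numFieldNormedType.Exports.

Local Open Scope classical_set_scope.
Local Open Scope fset_scope.
Local Open Scope ring_scope.

(* Each (n, s, B) compares the laws of the random vector
   (X_(s_0), ..., X_(s_(n-1))) on the Borel sets B of R^n. *)
Definition same_fdd (T : choiceType) (R : realType)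
    (d1 : measure_display) (O1 : measurableType d1) (P1 : probability O1 R)
    (d2 : measure_display) (O2 : measurableType d2) (P2 : probability O2 R)
    (X1 : T -> O1 -> R) (X2 : T -> O2 -> R) : Prop :=
  forall (n : nat) (s : n.-tuple T) (B : set (n.-tuple R)), measurable B ->
    P1 ((fun w => [tuple X1 (tnth s i) w | i < n]) @^-1` B) =
    P2 ((fun w => [tuple X2 (tnth s i) w | i < n]) @^-1` B).

Definition process_sigma_algebra (T : choiceType) (R : realType)
    (d : measure_display) (O : measurableType d) (X : T -> O -> R)
    : set (set O) :=
  <<s \bigcup_t preimage_set_system setT (X t) measurable >>.

(* The product rule for subfamilies is the case where some events are setT. *)
Definition independent_processes (T : choiceType) (R : realType)
    (d : measure_display) (O : measurableType d) (P : probability O R)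
    (n : nat) (Y : 'I_n -> T -> O -> R) : Prop :=
  forall E : 'I_n -> set O, (forall i, process_sigma_algebra (Y i) (E i)) ->
    P (\bigcap_i E i) = (\prod_(i < n) P (E i))%E.

(* The copies may live on any probability space.  Their number is n.+1, since
   the maximum of no copies is meaningless; the default value Y ord0 t w of the
   iterated maximum is one of its arguments. *)
Definition max_stable (T : choiceType) (R : realType)
    (d : measure_display) (O : measurableType d) (P : probability O R)
    (X : T -> {RV P >-> R}) : Prop :=
  forall (n : nat) (d' : measure_display) (O' : measurableType d')
    (P' : probability O' R) (Y : 'I_n.+1 -> T -> {RV P' >-> R}),
    (forall i, same_fdd P' P (fun t => Y i t : O' -> R)
                             (fun t => X t : O -> R)) ->
    independent_processes P' (fun i t => Y i t : O' -> R) ->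
    same_fdd P' P (fun t w => \big[Num.max/Y ord0 t w]_(i < n.+1) Y i t w)
                  (fun t w => n.+1%:R * X t w).

Definition unit_frechet_margins (T : choiceType) (R : realType)
    (d : measure_display) (O : measurableType d) (P : probability O R)
    (X : T -> {RV P >-> R}) : Prop :=
  forall (t : T) (x : R), 0 < x ->
    P [set w | X t w <= x] = (expR (- x^-1))%:E.

Definition simple_max_stable (T : choiceType) (R : realType)
    (d : measure_display) (O : measurableType d) (P : probability O R)
    (X : T -> {RV P >-> R}) : Prop :=
  unit_frechet_margins X /\ max_stable X.

(* [theta] is the extremal coefficient function of [X].  The logarithm is the
   extended one, with lne 0 = -oo, whereas ln 0 = 0. *)
Definition is_ECF (T : choiceType) (R : realType)
    (d : measure_display) (O : measurableType d) (P : probability O R)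
    (X : T -> {RV P >-> R}) (theta : {fset T} -> R) : Prop :=
  [/\ forall A, 0 <= theta A,
      theta fset0 = 0
    & forall A : {fset T}, A != fset0 -> forall x : R, 0 < x ->
      ((theta A)%:E =
       - x%:E * lne (P [set w | \big[maxe/-oo]_(t <- A) (X t w)%:E <= x%:E]))%E].

Definition tau (T : choiceType) (R : realType) (theta : {fset T} -> R)
    (M L : {fset T}) : R :=
  \sum_(I <- fpowerset L)
    (-1) ^+ (#|` I| + 1) * theta ((M `\` L) `|` I).

(* The inverse is that of \bar R, so 0^-1 = +oo, and 0 * +oo = 0. *)
Definition tm_exponent (T : choiceType) (R : realType)
    (theta : {fset T} -> R) (M : {fset T}) (x : T -> R) : \bar R :=
  (\sum_(L <- fpowerset M | L != fset0)
    (tau theta M L)%:E * \big[maxe/-oo]_(t <- L) ((x t)%:E)^-1)%E.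

(* [X] has the law of the Tawn-Molchanov process associated with [theta];
   only the values of [x] on [M] matter. *)
Definition is_TM (T : choiceType) (R : realType)
    (d : measure_display) (O : measurableType d) (P : probability O R)
    (X : T -> {RV P >-> R}) (theta : {fset T} -> R) : Prop :=
  simple_max_stable X /\
  forall (M : {fset T}), M != fset0 ->
  forall x : T -> R, (forall t, t \in M -> 0 < x t) ->
    (- lne (P [set w | forall t, t \in M -> (X t w <= x t)%R]) =
     tm_exponent theta M x)%E.

(* Main.v *)
(** Write [F] for the distribution function of [X] on [M] and [y_t = 1 / x_t].
    Max-stability, applied to independent copies of [X] on an iterated product
    space, gives [F (n x) ^ n = F x], i.e. [F (n x) = exp (- l / n)] with
    [l = - ln (F x)].  By inclusion-exclusion [tau theta M L] is the limit of
    [c P (atom X M L c)] as [c] tends to infinity, where [atom X M L c] is the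
    event that [L] is the set of the [t] in [M] with [X_t > c]; hence
    [0 <= tau theta M L], and the [tau theta M L] with [L] meeting [A] add up
    to [theta A].  Decompose [y] into its layers, [y = \sum_i c_i 1_(A_i)] with
    nested [A_i]; then [max_L y] is the sum of the [c_i] with [A_i] meeting
    [L], so the exponent of the Tawn-Molchanov process at [x] is
    [\sum_i c_i theta (A_i)].  Finally [l <= \sum_i c_i theta (A_i)] because
    [max_t y_t X_t <= \sum_i c_i max_(A_i) X] (for nonnegative [X]), and the
    mean of a variable with tail [~ a / z], truncated at [B], grows like
    [a log B].  If some [x_t] vanishes, both sides are [0]. *)
Require Import Defs.
From mathcomp Require Import all_boot all_order all_algebra finmap.
From mathcomp Require Import all_classical all_reals all_analysis.
From mathcomp Require Import ring lra.

Import Order.TTheory GRing.Theory Num.Theory.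
Local Open Scope classical_set_scope.
Local Open Scope fset_scope.
Local Open Scope ring_scope.

(** * Independent copies and the distribution function of a max-stable process *)

Lemma iid_copies {R : realType} {d : measure_display} {O : measurableType d}
    (P : probability O R) (n : nat) :
  exists (d' : measure_display) (Om : measurableType d')
    (P' : probability Om R) (pr : 'I_n -> {mfun Om >-> O}),
    forall F : 'I_n -> set O, (forall i, measurable (F i)) ->
      P' (\bigcap_i (pr i @^-1` F i)) = (\prod_(i < n) P (F i))%E.
Proof.
elim: n => [|n [d' [Om [P' [pr prE]]]]].
  exists d, O, P, (fun=> cst point) => F mF.
  rewrite big_ord0 -(probability_setT P); congr (P _).
  by apply/seteqP; split => // w _ [].
exists (d, d').-prod%mdisp, (O * Om)%type.
exists (P \x P')%E.
pose mfst : {mfun (O * Om)%type >-> O} := mfun_Sub (mem_set measurable_fst).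
pose msnd : {mfun (O * Om)%type >-> Om} := mfun_Sub (mem_set measurable_snd).
pose pr' (i : 'I_n.+1) : {mfun (O * Om)%type >-> O} :=
  if unlift ord0 i is Some j then (pr j \o msnd)%FUN else mfst.
exists pr' => F mF.
have -> : \bigcap_i (pr' i @^-1` F i) =
    (F ord0 `*` \bigcap_j (pr j @^-1` F (lift ord0 j)))%classic.
  apply/seteqP; split => [w Fw|w [F0 F1] i _].
    split=> [|j _].
      by have := Fw ord0 I; rewrite /pr' unlift_none.
    by have := Fw (lift ord0 j) I; rewrite /pr' /preimage/= liftK.
  rewrite /pr' /preimage/=; case: unliftP => [j ->|->] //=.
  exact: F1.
rewrite [LHS]product_measure1E//; last first.
  by apply: fin_bigcap_measurable => // j _; rewrite -[_ @^-1` _]setTI;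
    exact: measurable_funP.
by rewrite big_ord_recl/= prE.
Qed.

Definition below {R : realType} {T : choiceType} {O : Type} (X : T -> O -> R)
    (M : {fset T}) (x : T -> R) : set O :=
  [set w | forall t, t \in M -> X t w <= x t].

Lemma measurable_below {R : realType} {T : choiceType} {d : measure_display}
    {O : measurableType d} (X : T -> {mfun O >-> R}) (M : {fset T})
    (x : T -> R) : measurable (below X M x).
Proof.
rewrite (_ : below X M x = \bigcap_(t in [set` M]) (X t @^-1` `]-oo, x t])).
  apply: fin_bigcap_measurable => // t _; rewrite -[_ @^-1` _]setTI.
  exact: measurable_funP.
apply/seteqP; split => w Aw t tM; first by rewrite /= in_itv/=; exact: Aw.
by have := Aw t tM; rewrite /preimage/= in_itv.
Qed.

(** A maximum is at most [x] exactly when every copy is, so independence turns its distribution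
    function into a power; max-stability gives the maximum the law of [n.+1 * X]. *)
Lemma max_stable_cdf {R : realType} {T : choiceType} {d : measure_display}
    {O : measurableType d} {P : probability O R} {X : T -> {RV P >-> R}}
    (n : nat) (M : {fset T}) (x : T -> R) : max_stable X ->
  (P (below X M x) ^+ n.+1 =
   P (below (fun t w => n.+1%:R * X t w)%R M x))%E.
Proof.
move=> msX.
have [d' [Om [P' [pr prE]]]] := iid_copies P n.+1.
pose Y (i : 'I_n.+1) (t : T) : {RV P' >-> R} := (X t \o pr i)%FUN.
(* Each projection has law [P]: the other coordinates are left free and contribute factors [1]. *)
have prE1 i F : measurable F -> P' (pr i @^-1` F) = P F.
  move=> mF; pose G j := if j == i then F else setT.
  have mG j : measurable (G j) by rewrite /G; case: ifP.
  have := prE G mG; rewrite (bigD1 i)//= {2}/G eqxx big1 ?mule1; last first.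
    by move=> j /negbTE ji; rewrite /G ji probability_setT.
  move=> <-; congr (P' _); apply/seteqP; split => [w Fw j _|w /(_ i I)].
    by rewrite /G; case: eqP => [->|_].
  by rewrite /G /preimage/= eqxx.
(* The preimages under [pr i] form a sigma-algebra making every [Y i t] measurable, so every event
   of [Y i] is one of them and independence reduces to [prE]. *)
have sigmaY i E : process_sigma_algebra (fun t => Y i t : Om -> R) E ->
    exists2 F, measurable F & E = pr i @^-1` F.
  move=> YE.
  have [F mF FE] : preimage_set_system setT (pr i) measurable E.
    apply: smallest_sub YE.
      exact/sigma_algebra_preimage/sigma_algebra_measurable.
    move=> A [t _ [B mB <-]]; exists (X t @^-1` B); rewrite ?setTI//.
    by rewrite -[_ @^-1` _]setTI; exact: measurable_funP.
  by exists F; rewrite // -FE setTI.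
have Yfdd i : same_fdd P' P (fun t => Y i t : Om -> R) (fun t => X t : O -> R).
  move=> m s B mB; rewrite -(prE1 i)// -[_ @^-1` _]setTI.
  suff : measurable_fun setT (fun w => [tuple X (tnth s j) w | j < m]) by apply.
  apply/measurable_fun_tnthP => j.
  rewrite (_ : _ \o _ = X (tnth s j)); first exact: measurable_funP.
  by apply/funext => w /=; rewrite tnth_mktuple.
have Yind : independent_processes P' (fun i t => Y i t : Om -> R).
  move=> E YE; have /choice[F FE] : forall i, exists F,
      measurable F /\ E i = pr i @^-1` F.
    by move=> i; have [F mF EF] := sigmaY i (E i) (YE i); exists F.
  have -> : E = fun i => pr i @^-1` F i by apply/funext => i; case: (FE i).
  rewrite prE; last by move=> i; case: (FE i).
  by apply: eq_bigr => i _; rewrite prE1//; case: (FE i).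
pose s := in_tuple (enum_fset M).
pose B := [set v : (size M).-tuple R | forall j, tnth v j <= x (tnth s j)].
have mB : measurable B.
  rewrite (_ : B = \bigcap_j ((@tnth _ R)^~ j @^-1` `]-oo, x (tnth s j)])).
    apply: fin_bigcap_measurable => // j _; rewrite -[_ @^-1` _]setTI.
    exact: measurable_tnth.
  apply/seteqP; split => v Bv j; first by move=> _; rewrite /= in_itv/=.
  by have := Bv j I; rewrite /preimage/= in_itv.
have sM (Z : T -> R) :
    (forall j, tnth [tuple Z (tnth s i) | i < size M] j <= x (tnth s j)) <->
    (forall t, t \in M -> Z t <= x t).
  split => [ZB t tM|ZB j]; last by rewrite tnth_mktuple; apply/ZB/mem_tnth.
  by have /tnthP[j ->] : t \in s := tM; have := ZB j; rewrite tnth_mktuple.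
have := msX n d' Om P' Y Yfdd Yind _ s B mB.
set A := below _ _ _; set A' := below _ _ _.
have mA : measurable A by exact: measurable_below.
rewrite [X in _ = P X](_ : _ = A'); last first.
  apply/seteqP; split => w; first exact: (sM (fun t => n.+1%:R * X t w)).1.
  exact: (sM (fun t => n.+1%:R * X t w)).2.
move=> <-; rewrite [X in _ = P' X](_ : _ = \bigcap_i (pr i @^-1` A)).
  by rewrite prE// big_const_ord iter_mule mule1.
pose Z w t := \big[Num.max/Y ord0 t w]_(i < n.+1) Y i t w.
apply/seteqP; split => w Aw.
  move=> i _ t tM; apply: le_trans ((sM (Z w)).1 Aw t tM).
  exact: (le_bigmax _ (fun i => Y i t w) i).
apply: (sM (Z w)).2 => t tM; apply/bigmax_leP; split=> [|i _]; exact: Aw.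
Qed.

(** * Integration of pointwise relations between indicators *)

Lemma expectation_indic_ge0 {R : realType} {d : measure_display}
    {O : measurableType d} (P : probability O R) {I : Type} (r : seq I)
    (k : R) (a : I -> R) (E : I -> set O) :
  (forall i, measurable (E i)) ->
  (forall w, 0 <= k + \sum_(i <- r) a i * \1_(E i) w) ->
  0 <= k + \sum_(i <- r) a i * fine (P (E i)).
Proof.
(* The constant [k] becomes the coefficient of the sure event, indexed by [None]. *)
move=> mE; pose a' (i : option I) := if i is Some j then a j else k.
pose E' (i : option I) := if i is Some j then E j else setT.
pose r' := None :: map Some r.
have mE' i : measurable (E' i) by case: i => [i|] /=.
have -> : k + \sum_(i <- r) a i * fine (P (E i)) =
    \sum_(i <- r') a' i * fine (P (E' i)).
  by rewrite big_cons big_map/= probability_setT mulr1.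
have intE i : P.-integrable setT (fun w => (a' i)%:E * (\1_(E' i) w)%:E)%E.
  exact/integrableZl/integrable_indic.
have := integral_sum measurableT intE r' xpredT.
have -> : (\sum_(i <- r') \int[P]_w ((a' i)%:E * (\1_(E' i) w)%:E) =
    (\sum_(i <- r') a' i * fine (P (E' i)))%:E)%E.
  rewrite -sumEFin; apply: eq_bigr => i _.
  rewrite integralZl//; last exact: integrable_indic.
  by rewrite integral_indic// setIT EFinM fineK// fin_num_measure.
move=> + pos; rewrite -lee_fin => <-; apply: integral_ge0 => w _.
under eq_bigr do rewrite -EFinM; rewrite sumEFin lee_fin.
by rewrite big_cons big_map/= indicT mulr1.
Qed.

Lemma expectation_indic_le {R : realType} {d : measure_display}
    {O : measurableType d} (P : probability O R) {I J : Type}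
    (r : seq I) (s : seq J) (k : R) (a : I -> R) (b : J -> R)
    (E : I -> set O) (F : J -> set O) :
  (forall i, measurable (E i)) -> (forall j, measurable (F j)) ->
  (forall w, \sum_(i <- r) a i * \1_(E i) w <=
             k + \sum_(j <- s) b j * \1_(F j) w) ->
  \sum_(i <- r) a i * fine (P (E i)) <=
  k + \sum_(j <- s) b j * fine (P (F j)).
Proof.
move=> mE mF EF.
pose c (i : I + J) := match i with inl i => - a i | inr j => b j end.
pose G (i : I + J) := match i with inl i => E i | inr j => F j end.
have mG i : measurable (G i) by case: i => i /=.
have := expectation_indic_ge0 P (map inl r ++ map inr s) k c G mG.
rewrite big_cat !big_map/=; under eq_bigr do rewrite mulNr.
rewrite sumrN addrCA addrC subr_ge0; apply => w.
rewrite big_cat !big_map/=; under eq_bigr do rewrite mulNr.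
by rewrite sumrN addrCA addrC subr_ge0.
Qed.

Lemma expectation_indic_eq {R : realType} {d : measure_display}
    {O : measurableType d} (P : probability O R) {I J : Type}
    (r : seq I) (s : seq J) (k : R) (a : I -> R) (b : J -> R)
    (E : I -> set O) (F : J -> set O) :
  (forall i, measurable (E i)) -> (forall j, measurable (F j)) ->
  (forall w, \sum_(i <- r) a i * \1_(E i) w =
             k + \sum_(j <- s) b j * \1_(F j) w) ->
  \sum_(i <- r) a i * fine (P (E i)) =
  k + \sum_(j <- s) b j * fine (P (F j)).
Proof.
move=> mE mF EF; apply/eqP; rewrite eq_le; apply/andP; split.
  by apply: expectation_indic_le => // w; rewrite EF.
rewrite -lerBrDl addrC; apply: expectation_indic_le => // w.
by rewrite EF addKr.
Qed.

(** * Inclusion-exclusion over finite subsets *)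

Lemma big_fpowersetU1 {V : nmodType} {T : choiceType} (t : T) (A : {fset T})
    (F : {fset T} -> V) : t \notin A ->
  \sum_(I <- fpowerset (t |` A)) F I =
  \sum_(I <- fpowerset A) F I + \sum_(I <- fpowerset A) F (t |` I).
Proof.
move=> tA; pose h I := t |` I.
have tI I : I \in fpowerset A -> t \notin I.
  by rewrite fpowersetE => /fsubsetP IA; apply: contra tA => /IA.
rewrite -[X in _ + X](big_map h xpredT F) -big_cat/=; apply: perm_big.
apply: uniq_perm; first exact: fset_uniq.
  rewrite cat_uniq fset_uniq/= map_inj_in_uniq ?fset_uniq ?andbT.
    apply/hasPn => _ /mapP[I IA ->]; apply/negP => /tI.
    by rewrite /h fset1U1.
  move=> I J /tI tnI /tI tnJ /(congr1 (fun K => K `\ t)).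
  by rewrite /h !fsetU1K.
move=> J; rewrite mem_cat; apply/idP/orP => [|[|/mapP[I + ->]]].
- rewrite fpowersetE => JA; have [tJ|tJ] := boolP (t \in J).
    right; apply/mapP; exists (J `\ t); last by rewrite /h fsetD1K.
    by rewrite fpowersetE -(fsetU1K tA); exact: fsetSD.
  left; rewrite fpowersetE; apply/fsubsetP => s sJ.
  have := fsubsetP JA _ sJ; rewrite !inE => /orP[/eqP st|//].
  by rewrite -st sJ in tJ.
- rewrite !fpowersetE => /fsubset_trans; apply; exact: fsubsetU1.
- by rewrite !fpowersetE => IA; exact: fsetUS.
Qed.

(** Multiplying out chooses [1] or [- f t] for each [t]. With indicators for [f] this is
    inclusion-exclusion; with [f = 1] the alternating sum over the subsets of a non-empty set
    vanishes. *)
Lemma prod_1B_fpowerset {R : comNzRingType} {T : choiceType} (L : {fset T})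
    (f : T -> R) :
  \sum_(I <- fpowerset L) (-1) ^+ #|` I| * \prod_(t <- I) f t =
  \prod_(t <- L) (1 - f t).
Proof.
elim/fset1U_rect: L => [|t L tL IH].
  by rewrite fpowerset0 big_seq_fset1 cardfs0 !big_seq_fset0 mulr1.
rewrite big_fpowersetU1// big_fsetU1//= mulrBl mul1r -IH; congr (_ + _).
rewrite mulr_sumr -sumrN; apply: eq_big_seq => I.
rewrite fpowersetE => /fsubsetP IL.
have tI : t \notin I by apply: contra tL => /IL.
by rewrite cardfsU1 tI big_fsetU1//= exprD expr1; ring.
Qed.

(** * Extremal coefficients and scaling of the distribution function *)

Lemma is_ECF_below {R : realType} {T : choiceType} {d : measure_display}
    {O : measurableType d} {P : probability O R} {X : T -> {RV P >-> R}}
    {theta : {fset T} -> R} (A : {fset T}) (c : R) :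
  is_ECF X theta -> 0 < c ->
  P (below X A (fun=> c)) = (expR (- (theta A / c)))%:E.
Proof.
move=> [_ theta0 thetaE] c0; have [->|A0] := eqVneq A fset0.
  rewrite theta0 mul0r oppr0 expR0 -(probability_setT P); congr (P _).
  by apply/seteqP; split.
have := thetaE A A0 c c0; rewrite (_ : [set _ | _] = below X A (fun=> c)).
  have mb := measurable_below X A (fun=> c).
  rewrite -(@fineK _ (P _)) ?fin_num_measure//.
  set p := fine _; rewrite /lne; case: ifPn => [_|].
    (* A zero probability would make the right-hand side [+oo], whereas [theta A] is finite. *)
    by rewrite mulNe mulrNy gtr0_sg// mul1e.
  rewrite -ltNge => p0 [->]; congr (_%:E).
  by rewrite !mulNr opprK mulrAC divff ?gt_eqF// mul1r lnK.
apply/seteqP; split => w /=.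
  move=> h t tA; rewrite -lee_fin; apply: le_trans h.
  exact: (le_bigmax_seq _ t xpredT (fun t => (X t w)%:E)).
move=> h; rewrite big_seq; apply: bigmax_le; first exact: leNye.
by move=> t tA; rewrite lee_fin; exact: h.
Qed.

Lemma max_stable_below {R : realType} {T : choiceType} {d : measure_display}
    {O : measurableType d} {P : probability O R} {X : T -> {RV P >-> R}}
    (n : nat) (M : {fset T}) (x : T -> R) (l : R) :
  max_stable X -> P (below X M x) = (expR (- l))%:E ->
  P (below X M (fun t => n.+1%:R * x t)) = (expR (- (l / n.+1%:R)))%:E.
Proof.
move=> msX Pl.
have := max_stable_cdf n M (fun t => n.+1%:R * x t) msX.
have -> : below (fun t w => n.+1%:R * X t w) M (fun t => n.+1%:R * x t) =
    below X M x.
  by apply/seteqP; split => w h t /h; rewrite ler_pM2l.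
have mb := measurable_below X M (fun t => n.+1%:R * x t).
rewrite Pl -[P _]fineK ?fin_num_measure// -EFin_expe => -[pE]; congr (_%:E).
apply/eqP; rewrite -(eqrXn2 (n := n.+1))// ?expR_ge0 ?fine_ge0//.
by rewrite pE -expRM_natr mulNr divfK.
Qed.

(** * Elementary estimates with explicit rates *)

Lemma onem_expRN_bounds {R : realType} (u : R) : 0 <= u ->
  u - u ^+ 2 <= 1 - expR (- u) <= u.
Proof.
move=> u0; apply/andP; split; last first.
  by have := expR_ge1Dx (- u); lra.
rewrite expRN; have e0 := expR_gt0 u.
suff : (expR u)^-1 <= 1 - u + u ^+ 2 by lra.
(* This follows from [1 + u <= expR u] and [(1 - u + u^2) (1 + u) = 1 + u^3 >= 1]. *)
rewrite invf_ple ?posrE//; last by nra.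
apply: le_trans (expR_ge1Dx u); rewrite -[leLHS]mul1r ler_pdivrMr; last by nra.
by rewrite -subr_ge0 (_ : _ - _ = u ^+ 3) ?exprn_ge0//; ring.
Qed.

(** The Archimedean property; it stands in for limits whose error is of order [1 / n]. *)
Lemma le0_harmonic {R : realType} (a b : R) :
  (forall n : nat, a <= b / n.+1%:R) -> a <= 0.
Proof.
move=> ab; rewrite leNgt; apply/negP => a0.
have /archi_boundP : 0 <= `|b| / a by rewrite divr_ge0// ltW.
set n := Num.bound _; rewrite ltr_pdivrMr// => bn.
have := ab n; rewrite ler_pdivlMr ?ltr0n// leNgt => /negP; apply.
apply: (le_lt_trans (ler_norm b)); apply: (lt_trans bn).
by rewrite mulrC ltr_pM2l// ltr_nat.
Qed.

(** * Exceedance atoms and the coefficients [tau] *)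

Definition atom {R : realType} {T : choiceType} {O : Type} (X : T -> O -> R)
    (M L : {fset T}) (c : R) : set O :=
  [set w | forall t, t \in M -> (c < X t w) = (t \in L)].

Lemma measurable_atom {R : realType} {T : choiceType} {d : measure_display}
    {O : measurableType d} (X : T -> {mfun O >-> R}) (M L : {fset T}) (c : R) :
  measurable (atom X M L c).
Proof.
rewrite (_ : atom X M L c = \bigcap_(t in [set` M])
    (X t @^-1` [set` if t \in L then `]c, +oo[ else `]-oo, c]])).
  apply: fin_bigcap_measurable => // t _; rewrite -[_ @^-1` _]setTI.
  by apply: measurable_funP => //; case: ifP.
apply/seteqP; split => w Aw t tM.
  by have := Aw t tM; case: ifP => _ /= h; rewrite in_itv/= ?h// leNgt h.
have := Aw t tM; rewrite /preimage/=; case: ifP => _; rewrite in_itv/= ?andbT//.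
by rewrite leNgt => /negbTE.
Qed.

Lemma indic_below {R : realType} {T : choiceType} {O : Type} (X : T -> O -> R)
    (A : {fset T}) (x : T -> R) (w : O) :
  \1_(below X A x) w = \prod_(t <- A) (X t w <= x t)%R%:R :> R.
Proof.
rewrite indicE; have [h|] := boolP (all (fun t => X t w <= x t) A).
  rewrite mem_set; last by move=> t /(allP h).
  by rewrite big_seq big1// => t /(allP h) ->.
case/allPn => t tA /negbTE xt; rewrite (big_fsetD1 t)//= xt mul0r.
by rewrite memNset// => /(_ t tA); rewrite xt.
Qed.

(** On the atom, [X] is at most [c] on [M \ L] and exceeds [c] on all of [L]; the indicator of the
    latter is a product of factors [1 - f t], expanded by [prod_1B_fpowerset]. *)
Lemma indic_atom {R : realType} {T : choiceType} {O : Type} (X : T -> O -> R)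
    (M L : {fset T}) (c : R) (w : O) : L `<=` M ->
  \1_(atom X M L c) w = \sum_(I <- fpowerset L)
    (-1) ^+ #|` I| * \1_(below X ((M `\` L) `|` I) (fun=> c)) w :> R.
Proof.
move=> LM; under eq_bigr => I _.
  have -> : below X ((M `\` L) `|` I) (fun=> c) =
      (below X (M `\` L)%fset (fun=> c) `&` below X I (fun=> c))%classic.
    apply/seteqP; split => [w' h|w' [h1 h2] t].
      by split => t tI; apply: h; rewrite in_fsetU tI ?orbT.
    by rewrite in_fsetU => /orP[/h1|/h2].
  rewrite indicI /= [\1_(below X I _) w]indic_below mulrCA; over.
rewrite -mulr_sumr prod_1B_fpowerset.
have -> : \prod_(t <- L) (1 - (X t w <= c)%R%:R) =
    \prod_(t <- L) (c < X t w)%R%:R :> R.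
  by apply: eq_bigr => t _; rewrite ltNge; case: (X t w <= c);
    rewrite ?subrr ?subr0.
have [h|] := boolP (all (fun t => c < X t w) L); last first.
  case/allPn => t tL /negbTE xt; rewrite (big_fsetD1 t)//= xt mul0r mulr0.
  rewrite indicE memNset// => /(_ t (fsubsetP LM _ tL)).
  by rewrite xt tL.
rewrite [in RHS]big_seq big1 ?mulr1; last by move=> t /(allP h) ->.
rewrite !indicE; congr (_%:R); congr nat_of_bool; apply/idP/idP => /set_mem aw;
  apply/mem_set => t.
  by rewrite inE => /andP[/negbTE tL tM]; rewrite leNgt aw// tL.
move=> tM; have [tL|tL] := boolP (t \in L); first exact: (allP h).
by apply/negbTE; rewrite -leNgt; apply: aw; rewrite inE tL.
Qed.

(** Among the subsets of [M], only the exceedance set [S] of [w] has an atom containing [w], and [S]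
    meets [A] exactly when [X] exceeds [c] somewhere on [A]. *)
Lemma sum_indic_atom {R : realType} {T : choiceType} {O : Type}
    (X : T -> O -> R) (M A : {fset T}) (c : R) (w : O) : A `<=` M ->
  \sum_(L <- fpowerset M) (L `&` A != fset0)%:R * \1_(atom X M L c) w =
  1 - \1_(below X A (fun=> c)) w :> R.
Proof.
move=> AM; pose S := [fset t in M | c < X t w].
have SM : S \in fpowerset M by rewrite fpowersetE; exact: fset_sub.
rewrite (big_fsetD1 S)//= big_seq big1 ?addr0; last first.
  move=> L; rewrite !inE fpowersetE => /andP[LS LM].
  rewrite indicE memNset ?mulr0// => aw; case/eqP: LS; apply/fsetP => t.
  rewrite !inE/=; have [tM|tM] := boolP (t \in M); first by rewrite aw.
  by apply/negbTE; apply: contra tM => /(fsubsetP LM).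
rewrite [\1_(atom _ _ _ _) w]indicE mem_set ?mulr1; last first.
  by move=> t tM; rewrite !inE/= tM.
rewrite indicE; case: eqP => SA /=.
  rewrite mem_set ?subrr// => t tA; rewrite leNgt; apply/negP => cX.
  suff : t \in S `&` A by rewrite SA inE.
  by rewrite !inE/= (fsubsetP AM _ tA) cX.
rewrite memNset ?subr0// => bw; apply: SA; apply/fsetP => t; rewrite !inE/=.
by have [/bw|] := boolP (t \in A); rewrite ?andbF// leNgt => /negbTE ->;
  rewrite andbF.
Qed.

Lemma prob_atom {R : realType} {T : choiceType} {d : measure_display}
    {O : measurableType d} {P : probability O R} {X : T -> {RV P >-> R}}
    {theta : {fset T} -> R} (M L : {fset T}) (c : R) :
  is_ECF X theta -> 0 < c -> L `<=` M ->
  fine (P (atom X M L c)) = \sum_(I <- fpowerset L)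
    (-1) ^+ #|` I| * expR (- (theta ((M `\` L) `|` I) / c)).
Proof.
move=> thetaX c0 LM.
have := @expectation_indic_eq _ _ _ P unit {fset T} [:: tt] (fpowerset L) 0
  (fun=> 1) (fun I => (-1) ^+ #|` I|) (fun=> atom X M L c)
  (fun I => below X ((M `\` L) `|` I) (fun=> c)).
rewrite big_seq1 add0r mul1r => ->; last 3 first.
- by move=> _; exact: measurable_atom.
- by move=> I; exact: measurable_below.
- by move=> w; rewrite big_seq1 mul1r add0r; exact: indic_atom.
by apply: eq_bigr => I _; rewrite (is_ECF_below _ _ thetaX c0).
Qed.

Lemma sum_prob_atom {R : realType} {T : choiceType} {d : measure_display}
    {O : measurableType d} {P : probability O R} {X : T -> {RV P >-> R}}
    {theta : {fset T} -> R} (M A : {fset T}) (c : R) :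
  is_ECF X theta -> 0 < c -> A `<=` M ->
  \sum_(L <- fpowerset M) (L `&` A != fset0)%:R * fine (P (atom X M L c)) =
  1 - expR (- (theta A / c)).
Proof.
move=> thetaX c0 AM.
have := @expectation_indic_eq _ _ _ P {fset T} unit (fpowerset M) [:: tt] 1
  (fun L => (L `&` A != fset0)%:R) (fun=> -1) (fun L => atom X M L c)
  (fun=> below X A (fun=> c)).
rewrite big_seq1 mulN1r (is_ECF_below _ _ thetaX c0)//; apply.
- by move=> L; exact: measurable_atom.
- by move=> _; exact: measurable_below.
- by move=> w; rewrite big_seq1 mulN1r; exact: sum_indic_atom.
Qed.

(** To first order [c (1 - expR (- v / c))] is [v], with error at most [v^2 / c]; this is applied to
    each term of [prob_atom]. *)
Lemma tau_atom {R : realType} {T : choiceType} {d : measure_display}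
    {O : measurableType d} {P : probability O R} {X : T -> {RV P >-> R}}
    {theta : {fset T} -> R} (M L : {fset T}) (c : R) :
  is_ECF X theta -> 0 < c -> L `<=` M -> L != fset0 ->
  `|tau theta M L - c * fine (P (atom X M L c))| <=
  (\sum_(I <- fpowerset L) theta ((M `\` L) `|` I) ^+ 2) / c.
Proof.
move=> thetaX c0 LM L0; have [theta_ge0 _ _] := thetaX.
(* Subtracting this vanishing sum turns each exponential of [prob_atom] into
   [expR (- (v / c)) - 1]. *)
have alt0 : \sum_(I <- fpowerset L) (-1) ^+ #|` I| = 0 :> R.
  have /= := prod_1B_fpowerset L (fun=> 1 : R).
  under eq_bigr do rewrite big1_eq mulr1; move=> ->.
  have /fset0Pn[t tL] := L0.
  by rewrite (big_fsetD1 t)//= subrr mul0r.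
rewrite (prob_atom M L c thetaX)//.
rewrite -[X in c * X]subr0 -[X in c * (_ - X)]alt0 -sumrB mulr_sumr
  -sumrB mulr_suml.
apply: le_trans (ler_norm_sum _ _ _) _; apply: ler_sum => I _.
set v := theta _; have v0 : 0 <= v / c.
  by apply: divr_ge0; [exact: theta_ge0|exact: ltW].
have -> : (-1) ^+ (#|` I| + 1) * v -
    c * ((-1) ^+ #|` I| * expR (- (v / c)) - (-1) ^+ #|` I|) =
    (-1) ^+ (#|` I| + 1) * (c * (v / c - (1 - expR (- (v / c))))).
  by rewrite exprD expr1; field; rewrite gt_eqF.
rewrite normrM normrX normrN1 expr1n mul1r normrM gtr0_norm//.
have -> : v ^+ 2 / c = c * (v / c) ^+ 2 by field; rewrite gt_eqF.
rewrite ler_pM2l//; have /andP[h1 h2] := onem_expRN_bounds _ v0.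
by rewrite ger0_norm; lra.
Qed.

Lemma tau_ge0 {R : realType} {T : choiceType} {d : measure_display}
    {O : measurableType d} {P : probability O R} {X : T -> {RV P >-> R}}
    {theta : {fset T} -> R} (M L : {fset T}) :
  is_ECF X theta -> L `<=` M -> L != fset0 -> 0 <= tau theta M L.
Proof.
move=> thetaX LM L0; rewrite -oppr_le0; apply: le0_harmonic => n.
have c0 : 0 < n.+1%:R :> R by rewrite ltr0n.
apply: le_trans (tau_atom _ _ _ thetaX c0 LM L0).
rewrite distrC; apply: le_trans (ler_norm _).
by rewrite lerDr mulr_ge0// ?fine_ge0.
Qed.

(** This is [sum_prob_atom] multiplied by [c], for large [c]: the left side approaches the sum of
    the coefficients, the right side [theta A]. *)
Lemma sum_tau {R : realType} {T : choiceType} {d : measure_display}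
    {O : measurableType d} {P : probability O R} {X : T -> {RV P >-> R}}
    {theta : {fset T} -> R} (M A : {fset T}) :
  is_ECF X theta -> A `<=` M ->
  \sum_(L <- fpowerset M) (L `&` A != fset0)%:R * tau theta M L = theta A.
Proof.
move=> thetaX AM; have [theta_ge0 _ _] := thetaX.
apply/eqP; rewrite -subr_eq0 -normr_le0.
pose K L := \sum_(I <- fpowerset L) theta ((M `\` L) `|` I) ^+ 2.
apply: (le0_harmonic _ (\sum_(L <- fpowerset M) K L + theta A ^+ 2)) => n.
set c : R := n.+1%:R; have c0 : 0 < c by rewrite ltr0n.
have cP := sum_prob_atom M A c thetaX c0 AM.
pose p L := fine (P (atom X M L c)).
have -> : \sum_(L <- fpowerset M) (L `&` A != fset0)%:R * tau theta M L -
    theta A =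
    \sum_(L <- fpowerset M) (L `&` A != fset0)%:R * (tau theta M L - c * p L) +
    (c * (1 - expR (- (theta A / c))) - theta A).
  rewrite addrA -cP mulr_sumr -big_split/=; congr (_ - _).
  by apply: eq_bigr => L _; rewrite /p; ring.
rewrite mulrDl; apply: le_trans (ler_normD _ _) _; apply: lerD.
  apply: le_trans (ler_norm_sum _ _ _) _; rewrite mulr_suml.
  rewrite big_seq [leRHS]big_seq; apply: ler_sum => L.
  rewrite fpowersetE normrM => LM.
  have K0 : 0 <= K L / c.
    by apply: divr_ge0; [apply: sumr_ge0 => I _; exact: sqr_ge0|exact: ltW].
  (* Sets [L] disjoint from [A] contribute nothing; any other is non-empty, as [tau_atom]
     requires. *)
  case: eqP => [_|/eqP LA]; first by rewrite normr0 mul0r.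
  rewrite normr1 mul1r; apply: tau_atom => //.
  by apply: contraNneq LA => ->; rewrite fset0I.
have v0 : 0 <= theta A / c by apply: divr_ge0; [exact: theta_ge0|exact: ltW].
have /andP[h1 h2] := onem_expRN_bounds _ v0.
have -> : theta A ^+ 2 / c = c * (theta A / c) ^+ 2 by field; rewrite gt_eqF.
have -> : c * (1 - expR (- (theta A / c))) - theta A =
    c * (1 - expR (- (theta A / c)) - theta A / c) by field; rewrite gt_eqF.
rewrite normrM gtr0_norm// ler_pM2l//; move: h1 h2.
set v := theta A / c => h1 h2; rewrite ler0_norm; lra.
Qed.

(** * Layer decomposition of a nonnegative function *)

Lemma max_layer_cake {R : realFieldType} {T : choiceType} (M : {fset T})
    (y : T -> R) : (forall t, t \in M -> 0 <= y t) ->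
  exists s : seq (R * {fset T}),
    (forall p, p \in s -> 0 < p.1 /\ p.2 `<=` M) /\
    (forall L, L `<=` M -> \big[Num.max/0]_(t <- L) y t =
       \sum_(p <- s) p.1 * (L `&` p.2 != fset0)%:R).
Proof.
(* Induction on the size of the support [A] of [y]. The layer peeled off is [A], weighted by the
   least value [c] of [y] on it; a minimiser leaves the support of the remainder [y']. *)
have [n] := ubnP #|` [fset t in M | 0 < y t]|.
elim: n y => // n IH y; set A := [fset t in M | 0 < y t]; rewrite ltnS => An y0.
have AM : A `<=` M by exact: fset_sub.
have yA t : t \in M -> t \notin A -> y t = 0.
  move=> tM; rewrite !inE/= tM/= -leNgt => yt.
  by apply/eqP; rewrite eq_le yt y0.
have [A0|/fset0Pn[t0 t0A]] := eqVneq A fset0.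
  exists [::]; split=> // L LM; rewrite big_nil big_seq.
  apply: big1_idem => [|t /(fsubsetP LM) tM]; first exact: maxxx.
  by rewrite yA// A0 inE.
have [t1 t1A y1] : exists2 t1, t1 \in A & forall t, t \in A -> y t1 <= y t.
  have [i _ imin] := @arg_minP _ _ A [` t0A] xpredT (fun i => y (val i)) isT.
  by exists (val i) => [|t tA]; [exact: valP|exact: (imin [` tA])].
set c := y t1; have c0 : 0 < c by move: t1A; rewrite !inE/= => /andP[].
pose y' t := Num.max 0 (y t - c).
have y'0 t : 0 <= y' t by rewrite le_max lexx.
have [|s [sP sE]] := IH y' _ (fun t _ => y'0 t).
  apply: leq_trans An; apply: fproper_ltn_card; rewrite fproperE.
  apply/andP; split.
    apply/fsubsetP => t; rewrite !inE/= => /andP[-> ] /=.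
    by rewrite lt_max ltxx/= subr_gt0; exact: lt_trans.
  apply/fsubsetPn; exists t1 => //.
  by rewrite !inE/= /y' subrr maxxx ltxx andbF.
exists ((c, A) :: s); split=> [p|L LM].
  by rewrite inE => /predU1P[->|/sP].
rewrite big_cons/= -sE//; have [LA|/fset0Pn[t2]] := eqVneq (L `&` A) fset0.
  rewrite mulr0 add0r big_seq [RHS]big_seq; apply: eq_bigr => t tL.
  have tM := fsubsetP LM _ tL.
  have /(yA t tM) yt : t \notin A.
    apply/negP => tA; have : t \in L `&` A by rewrite inE tL.
    by rewrite LA inE.
  by rewrite /y' yt max_l// sub0r oppr_le0 ltW.
(* As [L] meets [A], the maximum over [L] is at least [c], so passing from [y] to [y'] lowers it by
   exactly [c]. *)
rewrite inE mulr1 => /andP[t2L t2A]; apply/eqP; rewrite eq_le.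
apply/andP; split.
  rewrite big_seq; apply: bigmax_le => [|t tL].
    by apply: addr_ge0; [exact: ltW|exact: bigmax_ge_id].
  rewrite -lerBlDl; apply: le_trans (le_bigmax_seq _ t xpredT y' tL isT).
  by rewrite le_max lexx orbT.
have cmax : c <= \big[Num.max/0]_(t <- L) y t.
  exact: le_trans (y1 _ t2A) (le_bigmax_seq _ t2 xpredT y t2L isT).
rewrite addrC -lerBrDr big_seq; apply: bigmax_le => [|t tL].
  by rewrite subr_ge0.
rewrite ge_max subr_ge0 cmax lerB//.
exact: (le_bigmax_seq _ t xpredT y tL isT).
Qed.

(** * Counts as truncations, and their growth *)

Lemma count_below_bounds {R : realType} (z : R) (B : nat) : 0 <= z ->
  \sum_(n < B) (n.+1%:R < z)%R%:R <= Num.min z B%:R <=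
  1 + \sum_(n < B) (n.+1%:R < z)%R%:R.
Proof.
move=> z0; apply/andP; split.
  elim: B => [|B IH]; first by rewrite big_ord0 le_min z0 lexx.
  rewrite big_ord_recr/= le_min; move: IH; rewrite le_min => /andP[IHz IHB].
  rewrite -[in X in _ && X]natr1 lerD// ?lern1 ?leq_b1// andbT.
  case: ltP => [Bz|_]; last by rewrite addr0.
  by apply/ltW/(le_lt_trans _ Bz); rewrite -natr1 lerD2r.
(* Counting from [0] instead of [1] dominates the truncation; the extra term [n = 0] costs at most
   [1]. *)
have : Num.min z B%:R <= \sum_(n < B) (n%:R < z)%R%:R.
  elim: B => [|B IH]; first by rewrite big_ord0 ge_min lexx orbT.
  rewrite big_ord_recr/= ge_min; move: IH; rewrite ge_min.
  case: ltP => [Bz|zB]; last first.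
    by rewrite addr0 => /orP[->//|]; move=> /(le_trans zB) ->.
  move=> /orP[/(lt_le_trans Bz)|]; last by rewrite -natr1 lerD2r orbC => ->.
  by move=> /ltW; rewrite -natr1 lerD2r orbC => ->.
move=> /le_trans; apply; have : \sum_(n < B) (n%:R < z)%R%:R <=
    \sum_(n < B.+1) (n%:R < z)%R%:R :> R by rewrite big_ord_recr/= lerDl.
move=> /le_trans; apply; rewrite big_ord_recl/= lerD2r.
by case: ltP.
Qed.

(** Truncation at [B] is subadditive on nonnegative numbers, and passing back to counts costs [1]
    per summand. The total cost does not depend on [B], hence is negligible against a divergent
    sum. *)
Lemma count_below_sum {R : realType} {I : eqType} (s : seq I) (z : I -> R)
    (B : nat) : (forall i, i \in s -> 0 <= z i) ->
  \sum_(n < B) (n.+1%:R < \sum_(i <- s) z i)%R%:R <=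
  (size s)%:R + \sum_(i <- s) \sum_(n < B) (n.+1%:R < z i)%R%:R :> R.
Proof.
move=> z0; have sz0 : 0 <= \sum_(i <- s) z i.
  by rewrite big_seq; apply: sumr_ge0.
have /andP[/le_trans + _] := count_below_bounds _ B sz0; apply.
elim: s z0 {sz0} => [|i s IH] z0; first by rewrite !big_nil addr0 ge_min lexx.
have zi0 : 0 <= z i by apply: z0; rewrite inE eqxx.
have zs0 j : j \in s -> 0 <= z j by move=> js; apply: z0; rewrite inE js orbT.
have sz0 : 0 <= \sum_(i <- s) z i by rewrite big_seq; apply: sumr_ge0.
have /andP[_ iB] := count_below_bounds _ B zi0.
rewrite !big_cons/= -natr1.
apply: (@le_trans _ _ (Num.min (z i) B%:R + Num.min (\sum_(j <- s) z j) B%:R)).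
  have B0 : 0 <= B%:R :> R by [].
  rewrite /Num.min; do 3 (case: ltP => ?); lra.
by apply: le_trans (lerD iB (IH zs0)) _; lra.
Qed.

Lemma le0_series_harmonic {R : realType} (a b : R) :
  (forall B : nat, a * \sum_(n < B) n.+1%:R^-1 <= b) -> a <= 0.
Proof.
move=> ab; rewrite leNgt; apply/negP => a0; apply: (@dvg_harmonic R).
apply: nondecreasing_is_cvgn.
  by apply: nondecreasing_series => n _ _; exact: harmonic_ge0.
exists (b / a) => _ [B _ <-]; rewrite ler_pdivlMr// mulrC.
by rewrite /series/= big_mkord.
Qed.

Lemma sum_inv_sqr_le {R : realFieldType} (B : nat) :
  \sum_(n < B) n.+1%:R^-1 ^+ 2 <= 2 :> R.
Proof.
case: B => [|B]; first by rewrite big_ord0.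
(* Strengthened for the induction: [1/(c+1)^2 <= 1/c - 1/(c+1)]. *)
suff : \sum_(n < B.+1) n.+1%:R^-1 ^+ 2 <= 2 - B.+1%:R^-1 :> R.
  by move=> /le_trans; apply; rewrite gerBl invr_ge0.
elim: B => [|B IH]; first by rewrite big_ord_recr big_ord0/= invr1; lra.
rewrite big_ord_recr/=; apply: le_trans (lerD IH (lexx _)) _.
have c0 : 0 < B.+1%:R :> R by rewrite ltr0n.
rewrite -[B.+2%:R]natr1; set c : R := B.+1%:R in c0 *.
rewrite -subr_ge0 (_ : _ - _ = (c * (c + 1) ^+ 2)^-1).
  by rewrite invr_ge0 mulr_ge0 ?sqr_ge0// ltW.
by field; rewrite !gt_eqF// addr_gt0.
Qed.

Lemma fine_below_setC {R : realType} {T : choiceType} {d : measure_display}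
    {O : measurableType d} {P : probability O R} (X : T -> {RV P >-> R})
    (M : {fset T}) (x : T -> R) (a : R) :
  P (below X M x) = a%:E -> fine (P (~` below X M x)) = 1 - a.
Proof.
by move=> Pa; rewrite probability_setC ?Pa//; exact: measurable_below.
Qed.

(* Expectations of [#{n < B | n + 1 < Z}] replace the truncated means, so that
   only finite sums of probabilities occur. *)
Lemma below_exponent_le {R : realType} {T : choiceType} {d : measure_display}
    {O : measurableType d} {P : probability O R} {X : T -> {RV P >-> R}}
    {theta : {fset T} -> R} (M : {fset T}) (x : T -> R) (l : R)
    (s : seq (R * {fset T})) :
  is_ECF X theta -> max_stable X ->
  (forall t, t \in M -> 0 < x t) ->
  (forall p, p \in s -> 0 < p.1) ->
  (forall t, t \in M -> (x t)^-1 = \sum_(p <- s) p.1 * (t \in p.2)%:R) ->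
  P (below X M x) = (expR (- l))%:E -> 0 <= l ->
  l <= \sum_(p <- s) p.1 * theta p.2.
Proof.
move=> thetaX msX x0 s0 xs Pl l0; have [theta_ge0 _ _] := thetaX.
have key B : \sum_(n < B) (1 - expR (- (l / n.+1%:R))) <=
    (size s)%:R + \sum_(p <- s) \sum_(n < B) p.1 * theta p.2 / n.+1%:R.
  (* With [Z = max_t X_t / x_t], [E n] is the event [Z > n.+1], and [F (p, n)] the event that
     [p.1 * max_(p.2) X] exceeds [n.+1]. *)
  pose E n := ~` below X M (fun t => n.+1%:R * x t).
  pose F (p : (R * {fset T}) * 'I_B) :=
    ~` below X p.1.2 (fun=> p.2.+1%:R / p.1.1).
  have mE n : measurable (E n) by apply/measurableC/measurable_below.
  have mF p : measurable (F p) by apply/measurableC/measurable_below.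
  have := @expectation_indic_le _ _ _ P 'I_B _ (index_enum 'I_B)
    [seq (p, n) | p <- s, n <- index_enum 'I_B] (size s)%:R
    (fun=> 1) (fun=> 1) E F (fun n => mE n) mF.
  rewrite big_allpairs/=.
  have -> : \sum_(n < B) 1 * fine (P (E n)) =
      \sum_(n < B) (1 - expR (- (l / n.+1%:R))).
    apply: eq_bigr => n _; rewrite mul1r; apply: fine_below_setC.
    exact: max_stable_below.
  move=> EF; apply: le_trans (EF _) _ => [w|].
    rewrite big_allpairs/=.
    (* The default [0] makes [z p] nonnegative even where [X] takes negative values. *)
    pose z (p : R * {fset T}) := p.1 * \big[Num.max/0]_(t <- p.2) X t w.
    have z0 p : p \in s -> 0 <= z p.
      by move=> /s0 p0; rewrite mulr_ge0 ?bigmax_ge_id// ltW.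
    apply: (@le_trans _ _ (\sum_(n < B) (n.+1%:R < \sum_(p <- s) z p)%R%:R)).
      apply: ler_sum => n _; rewrite mul1r indicE.
      case: (boolP (w \in E n)) => [/set_mem wE|//].
      suff -> : n.+1%:R < \sum_(p <- s) z p by [].
      rewrite ltNge; apply/negP => zn; apply: wE => t tM.
      (* [X_t / x_t] is the sum of the [p.1 * X_t] with [t] in [p.2], each at most [z p]; the other
         [z p] are nonnegative. *)
      rewrite -ler_pdivrMr ?x0// xs// mulr_sumr; apply: le_trans zn.
      rewrite big_seq [leRHS]big_seq; apply: ler_sum => p /s0 p0.
      rewrite mulrCA ler_pM2l//; case: (boolP (t \in p.2)) => tp.
        by rewrite mulr1; exact: (le_bigmax_seq _ t xpredT (X ^~ w)).
      by rewrite mulr0; exact: bigmax_ge_id.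
    apply: le_trans (count_below_sum _ _ _ z0) _.
    rewrite lerD2l big_seq [leRHS]big_seq; apply: ler_sum => p /s0 p0.
    apply: ler_sum => n _; rewrite mul1r indicE.
    case: ltP => // nz; rewrite mem_set// => pw; move: nz; apply/negP.
    rewrite -leNgt /z mulrC -ler_pdivlMr// big_seq; apply: bigmax_le.
      by rewrite divr_ge0// ltW.
    by move=> t /pw.
  rewrite lerD2l big_seq [leRHS]big_seq; apply: ler_sum => p /s0 p0.
  apply: ler_sum => n _; rewrite mul1r.
  have c0 : 0 < n.+1%:R / p.1 by rewrite divr_gt0.
  rewrite (fine_below_setC _ _ _ _ (is_ECF_below _ _ thetaX c0)).
  have v0 : 0 <= theta p.2 / (n.+1%:R / p.1).
    by apply: divr_ge0; [exact: theta_ge0|exact: ltW].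
  have /andP[_ /le_trans] := onem_expRN_bounds _ v0; apply.
  by rewrite invf_div mulrCA mulrA.
rewrite -subr_le0.
(* Up to the errors [size s] and [2 * l ^+ 2], bounded in [B], the left side of [key] is at least
   [l] times the harmonic sum, and the right side is the layer sum times it; divergence compares the
   slopes. *)
apply: (@le0_series_harmonic _ _ ((size s)%:R + 2 * l ^+ 2)) => B.
have := key B; rewrite exchange_big/=.
under [X in _ <= _ + X -> _]eq_bigr do rewrite -mulr_suml.
rewrite -mulr_sumr => {}key.
suff h : l * \sum_(n < B) n.+1%:R^-1 - 2 * l ^+ 2 <=
    \sum_(n < B) (1 - expR (- (l / n.+1%:R))) by lra.
apply: (@le_trans _ _ (\sum_(n < B) (l / n.+1%:R - (l / n.+1%:R) ^+ 2))).
  rewrite sumrB -mulr_sumr lerB//.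
  under eq_bigr do rewrite exprMn.
  by rewrite -mulr_sumr mulrC ler_wpM2r ?sqr_ge0// sum_inv_sqr_le.
apply: ler_sum => n _.
by have /andP[] := @onem_expRN_bounds _ (l / n.+1%:R) (divr_ge0 l0 (ler0n _ _)).
Qed.

(** * The exponent, and points with a vanishing coordinate *)

Lemma bigmaxe_inv {R : realType} {T : choiceType} (L : {fset T}) (x : T -> R) :
  L != fset0 -> (forall t, t \in L -> 0 < x t) ->
  (\big[maxe/-oo]_(t <- L) ((x t)%:E)^-1 =
   (\big[Num.max/0%R]_(t <- L) (x t)^-1)%:E)%E.
Proof.
move=> /fset0Pn[t0 t0L] x0; apply/eqP; rewrite eq_le; apply/andP; split.
  rewrite big_seq; apply: bigmax_le => [|t tL]; first exact: leNye.
  rewrite inver gt_eqF ?x0// lee_fin.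
  exact: (le_bigmax_seq _ t xpredT (fun t => (x t)^-1)).
have le_max t : t \in L ->
    ((x t)^-1%:E <= \big[maxe/-oo]_(t <- L) ((x t)%:E)^-1)%E.
  move=> tL; have := le_bigmax_seq -oo%E t xpredT (fun t => ((x t)%:E)^-1%E).
  by rewrite inver gt_eqF ?x0//; apply.
rewrite big_seq; elim/big_ind : _ => [|a b ha hb|t]; last exact: le_max.
  by apply: le_trans (le_max _ t0L); rewrite lee_fin invr_ge0 ltW// x0.
by rewrite EFin_max ge_max ha.
Qed.

Lemma bigmaxe_inv0 {R : realType} {T : choiceType} (L : {fset T}) (x : T -> R)
    (t : T) : t \in L -> x t = 0 ->
  (\big[maxe/-oo]_(t <- L) ((x t)%:E)^-1 = +oo)%E.
Proof.
move=> tL xt; apply/eqP; rewrite -leye_eq.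
have := le_bigmax_seq -oo%E t xpredT (fun t => ((x t)%:E)^-1%E) tL isT.
by rewrite xt inve0.
Qed.

Lemma tm_exponent_pos {R : realType} {T : choiceType}
    (theta : {fset T} -> R) (M : {fset T}) (x : T -> R) :
  (forall t, t \in M -> 0 < x t) ->
  tm_exponent theta M x = (\sum_(L <- fpowerset M | L != fset0)
    tau theta M L * \big[Num.max/0]_(t <- L) (x t)^-1)%:E.
Proof.
move=> x0; rewrite -sumEFin /tm_exponent big_seq_cond [RHS]big_seq_cond.
apply: eq_bigr => L; rewrite fpowersetE => /andP[LM L0].
by rewrite bigmaxe_inv// => t /(fsubsetP LM)/x0.
Qed.

(** The coefficients of the [L] containing [t] are nonnegative and add up to [theta [fset t] = 1],
    so one is positive; its term is [+oo] and no term is negative. *)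
Lemma tm_exponent0 {R : realType} {T : choiceType} {d : measure_display}
    {O : measurableType d} {P : probability O R} {X : T -> {RV P >-> R}}
    {theta : {fset T} -> R} (M : {fset T}) (x : T -> R) (t : T) :
  unit_frechet_margins X -> is_ECF X theta ->
  (forall t, t \in M -> 0 <= x t) -> t \in M -> x t = 0 ->
  tm_exponent theta M x = +oo%E.
Proof.
move=> frX thetaX x0 tM xt.
have theta1 : theta [fset t] = 1.
  have := is_ECF_below [fset t] 1 thetaX ltr01.
  rewrite (_ : below _ _ _ = [set w | X t w <= 1]).
    by rewrite frX// divr1 invr1 => -[/expR_inj/oppr_inj].
  apply/seteqP; split => w; first by apply; rewrite inE.
  by move=> h t'; rewrite inE => /eqP ->.
have term_ge0 L : L \in fpowerset M -> L != fset0 ->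
    (0 <= (tau theta M L)%:E * \big[maxe/-oo]_(t <- L) ((x t)%:E)^-1)%E.
  rewrite fpowersetE => LM L0; apply: mule_ge0.
    by rewrite lee_fin (tau_ge0 _ _ thetaX).
  have /fset0Pn[u uL] := L0.
  apply: le_trans (le_bigmax_seq _ u xpredT (fun t => ((x t)%:E)^-1%E) uL isT).
  by rewrite inve_ge0 lee_fin x0// (fsubsetP LM).
have [L [LM tL tau0]] : exists L, [/\ L `<=` M, t \in L & 0 < tau theta M L].
  apply: contrapT => noL; have tM1 : [fset t] `<=` M by rewrite fsub1set.
  have := sum_tau M [fset t] thetaX tM1.
  rewrite theta1 big_seq big1 => [/eqP|L]; first by rewrite eq_sym oner_eq0.
  rewrite fpowersetE => LM; case: eqP => [_|/eqP/fset0Pn[u]].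
    by rewrite mul0r.
  rewrite !inE => /andP[uL /eqP ut]; rewrite {u}ut in uL.
  rewrite mul1r; apply/eqP; rewrite eq_le (tau_ge0 _ _ thetaX)//; last first.
    by apply/fset0Pn; exists t.
  by rewrite andbT leNgt; apply/negP => tau0; apply: noL; exists L.
have L0 : L != fset0 by apply/fset0Pn; exists t.
have LP : L \in fpowerset M by rewrite fpowersetE.
apply/eqP; rewrite -leye_eq /tm_exponent big_mkcond (big_fsetD1 L)//= L0.
rewrite (bigmaxe_inv0 _ _ _ tL xt) gt0_muley ?lte_fin// leeDl//.
rewrite big_seq; apply: sume_ge0 => K; rewrite !inE => /andP[_ KP].
by case: ifPn => // K0; exact: term_ge0.
Qed.

(** The event lies in [X_t <= 1 / n.+1], whose probability [expR (- n.+1)] is at most [1 / n.+1]. *)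
Lemma prob_below0 {R : realType} {T : choiceType} {d : measure_display}
    {O : measurableType d} {P : probability O R} {X : T -> {RV P >-> R}}
    (M : {fset T}) (x : T -> R) (t : T) :
  unit_frechet_margins X -> t \in M -> x t = 0 -> P (below X M x) = 0%E.
Proof.
move=> frX tM xt; have mb := measurable_below X M x.
apply/eqP; rewrite eq_le measure_ge0 andbT -[P _]fineK ?fin_num_measure//.
rewrite lee_fin; apply: (@le0_harmonic _ _ 1) => n; rewrite mul1r.
have c0 : 0 < n.+1%:R^-1 :> R by rewrite invr_gt0.
apply: (@le_trans _ _ (expR (- n.+1%:R))).
  rewrite -lee_fin fineK ?fin_num_measure// -[n.+1%:R in leRHS]invrK -(frX t)//.
  apply: le_measure; rewrite ?inE//.
    rewrite -[X in measurable X](_ : below X [fset t] (fun=> n.+1%:R^-1) = _).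
      exact: measurable_below.
    apply/seteqP; split => w; first by apply; rewrite inE.
    by move=> h t'; rewrite inE => /eqP ->.
  by move=> w /(_ t tM) h; apply: (le_trans h); rewrite xt ltW.
rewrite expRN lef_pV2 ?posrE ?expR_gt0 ?ltr0n//.
by apply: le_trans (expR_ge1Dx _); lra.
Qed.

(** * The lower bound and the equality case *)

Lemma below_ge_tm_exponent {R : realType} {T : choiceType}
    {d : measure_display} {O : measurableType d} {P : probability O R}
    {X : T -> {RV P >-> R}} {theta : {fset T} -> R} (M : {fset T})
    (x : T -> R) : max_stable X -> is_ECF X theta ->
  (forall t, t \in M -> 0 < x t) ->
  (expeR (- tm_exponent theta M x) <= P (below X M x))%E.
Proof.
move=> msX thetaX x0; have [theta_ge0 _ _] := thetaX.
have mb := measurable_below X M x.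
(* A positive lower bound of the [x t]: the event contains [below X M (fun=> m)], of positive
   probability, so [l] is a genuine finite exponent. *)
pose m := \big[Num.min/1]_(t <- M) x t.
have m0 : 0 < m.
  by rewrite /m big_seq; elim/big_ind : _ => // a b a0 b0; rewrite lt_min a0.
have pos : 0 < fine (P (below X M x)).
  apply: (@lt_le_trans _ _ (expR (- (theta M / m)))); first exact: expR_gt0.
  rewrite -lee_fin fineK ?fin_num_measure// -(is_ECF_below M m thetaX m0).
  apply: le_measure; rewrite ?inE//; first exact: measurable_below.
  move=> w h t tM; apply: le_trans (h t tM) _.
  exact: (ge_bigmin_seq _ t xpredT x).
set l := - ln (fine (P (below X M x))).
have Pl : P (below X M x) = (expR (- l))%:E.
  by rewrite opprK lnK// fineK// fin_num_measure.
have l0 : 0 <= l by rewrite oppr_ge0 ln_le0// -lee_fin fineK ?fin_num_measure//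
  probability_le1.
have y0 t : t \in M -> 0 <= (x t)^-1 by move=> /x0 xt; rewrite invr_ge0 ltW.
have [s [sM sE]] := max_layer_cake _ _ y0.
rewrite tm_exponent_pos// Pl /= lee_fin ler_expR lerN2.
apply: (le_trans (y := \sum_(p <- s) p.1 * theta p.2)).
  apply: below_exponent_le Pl l0 => // [p /sM[]//|t tM].
  have st : [fset t] = [:: t] :> seq T.
    apply/perm_small_eq => //; apply/uniq_perm => // u.
    by rewrite !inE.
  have := sE [fset t]; rewrite fsub1set st big_cons big_nil max_l ?y0//.
  move=> -> //.
  apply: eq_bigr => p _; congr (_ * _%:R); congr nat_of_bool.
  by rewrite fsetI_eq0 fdisjoint1X negbK.
(* [sum_tau] expands each [theta p.2] over the [L] meeting [p.2]; after exchanging the sums, [sE]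
   recovers the maxima. *)
rewrite big_seq (eq_bigr (fun p => \sum_(L <- fpowerset M)
    p.1 * ((L `&` p.2 != fset0)%:R * tau theta M L))); last first.
  by move=> p /sM[_ pM]; rewrite -mulr_sumr (sum_tau _ _ thetaX).
rewrite -big_seq exchange_big/= [leRHS]big_mkcond/= le_eqVlt; apply/orP; left.
apply/eqP; rewrite big_seq [RHS]big_seq; apply: eq_bigr => L.
rewrite fpowersetE => LM; case: eqP => [->|_] /=.
  by rewrite big1// => p _; rewrite fset0I eqxx mul0r mulr0.
by rewrite sE// mulr_sumr; apply: eq_bigr => p _; ring.
Qed.

Theorem corollary33 (R : realType) (T : choiceType)
    (d : measure_display) (O : measurableType d) (P : probability O R)
    (X : T -> {RV P >-> R}) (theta : {fset T} -> R) (M : {fset T})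
    (hX : simple_max_stable X) (htheta : is_ECF X theta) (hM : M != fset0) :
  (forall x : T -> R, (forall t, t \in M -> 0 <= x t) ->
    (expeR (- tm_exponent theta M x) <=
     P [set w | forall t, t \in M -> (X t w <= x t)%R])%E) /\
  (is_TM X theta ->
   forall x : T -> R, (forall t, t \in M -> 0 <= x t) ->
     (P [set w | forall t, t \in M -> (X t w <= x t)%R] =
      expeR (- tm_exponent theta M x))%E).
Proof.
have [frX msX] := hX.
(* At a vanishing coordinate equality always holds, so both claims reduce to positive [x], the range
   covered by [is_TM]. *)
have zeroE x t : (forall t, t \in M -> 0 <= x t) -> t \in M -> ~ 0 < x t ->
    P (below X M x) = expeR (- tm_exponent theta M x)%E.
  move=> x0 tM /negP; rewrite -leNgt => xt0.
  have xt : x t = 0 by apply/eqP; rewrite eq_le xt0 x0.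
  rewrite (prob_below0 _ _ _ frX tM xt).
  by rewrite (tm_exponent0 _ _ _ frX htheta x0 tM xt).
have posP x : (forall t, t \in M -> 0 <= x t) ->
    (forall t, t \in M -> 0 < x t) \/
    P (below X M x) = expeR (- tm_exponent theta M x)%E.
  move=> x0; have [|/existsNP[t /not_implyP[tM xt]]] :=
    pselect (forall t, t \in M -> 0 < x t); first by left.
  by right; exact: zeroE xt.
split=> [x x0|[_ TM] x x0].
  have [xpos|xE] := posP x x0; first exact: below_ge_tm_exponent.
  by rewrite -/(below X M x) xE.
have [xpos|//] := posP x x0.
by rewrite -(TM M hM x xpos) oppeK lneK// in_itv/= leey measure_ge0.
Qed.
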